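(* A finite group $H$ is forcible if and only if $H$ is abelian and all of its Sylow subgroups are elementary-by-cyclic.
   Context: Let $G$ and $H$ be finite groups. We say $G$ forces $H$ if every finite group $U$ that has a quotient isomorphic to $G$ has a subgroup isomorphic to $H$. We say $H$ is forcible if some finite group $G$ forces $H$. For a prime $p$, an abelian $p$-group is called elementary-by-cyclic if it is isomorphic to $C_{p^m} \times C_p^n$ for some integers $m, n \ge 0$, where $C_k$ denotes the cyclic group of order $k$ and $C_k^n$ the direct product of $n$ copies of $C_k$. *)

(* Defs.v *)
From HB Require Import structures.
From mathcomp Require Import all_boot all_fingroup all_algebra all_solvable.

Set Implicit Arguments.
Unset Strict Implicit.
Unset Printing Implicit Defensive.

Import GroupScope.

Definition forces (gT hT : finGroupType) (G : {group gT}) (H : {group hT}) : Prop :=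
  forall (uT : finGroupType) (U : {group uT}),
    (exists2 N : {group uT}, N <| U & U / N \isog G) ->
    exists2 K : {group uT}, K \subset U & K \isog H.

Definition forcible (hT : finGroupType) (H : {group hT}) : Prop :=
  exists (gT : finGroupType) (G : {group gT}), forces G H.

(* C_(p ^ m) is Zp (p ^ m), which unlike [set: 'Z_(p ^ m)] is trivial for
   m = 0; C_p ^ n is the additive group of row vectors 'rV['F_p]_n, so p is
   meant to be prime ('F_p is the integers modulo pdiv p in general). *)
Definition elementary_by_cyclic (p : nat) (aT : finGroupType) (A : {group aT}) : Prop :=
  exists m n : nat, A \isog setX (Zp (p ^ m)%N) [set: 'rV['F_p]_n].

(* Main.v *)
(**
Sufficiency. Nilpotent supplements reduce the question to p-groups: if a group U maps
onto a nilpotent group, then so does a nilpotent subgroup of U (a minimal supplement, by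
the Frattini argument), and its Hall subgroups can be treated separately. Let U be a
p-group, q = p^2, and let A be maximal among the normal abelian subgroups of U of
exponent dividing q. By Alperin's theorem the centralizer C of A has no element of order
dividing q outside A, so these elements are central in C, and then, by Thompson's
argument, every quotient of C of exponent dividing q has order at most |A|. Hence
|U : K| <= |A|! |A| for every normal K such that U / K has exponent dividing q: if U has
a large elementary abelian quotient, then A is large, and U has a normal elementary
abelian subgroup V of order p^(n+1). If U also has an element x of large order, then a
power of x of order p^m centralizes V. So C_(p^M) x C_p^N forces C_(p^m) x C_p^n for
large M and N.

Necessity. If S <= G is the image of E under a map with abelian kernel of exponent
dividing k, then coinduction gives a cover U of G, again with abelian kernel of exponent
dividing k, such that the preimage of S in U maps to E over S. For S = <x> and E cyclic
of order k #[x], no lift of x != 1 has a trivial k-th power; for S = <x> x <y> of order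
p^2 and E extraspecial of order p^3, no lifts of x and y commute. A fibre product
achieves this for all x and y at once. Taking k = |H|, every copy of H in U lies in the
abelian kernel. Taking k = p, if a and b in H generate C_(p^2) x C_(p^2), then their
images in G generate a group C_p x C_p with commuting lifts, a contradiction; so the
p-th powers of a Sylow p-subgroup of H form a cyclic group.
*)

Require Import Defs.
From HB Require Import structures.
From mathcomp Require Import all_boot all_fingroup all_algebra all_solvable.

Import GroupScope.

Set Implicit Arguments.
Unset Strict Implicit.
Unset Printing Implicit Defensive.

(** * Elements of order dividing the square of p in a p-group *)

(** The square matters at p = 2: p choose 2 is then 1, while p^2 choose 2 is 6. *)
Lemma dvdn_bin2_sqr p : prime p -> p %| 'C(p ^ 2, 2).
Proof.
move=> p_pr; have [-> //|odd_p] := even_prime p_pr.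
by rewrite bin2odd ?oddX // expnS -mulnA dvdn_mulr.
Qed.

(** Put q = p^2. As [c] commutes with [x] and [y], the q-th power of y = x z differs from x^q z^q by
    a power of c whose exponent is a multiple of p, so c^p = 1 suffices. Since c^q = 1, x^p and y^p
    commute, so w^p = 1 and [x] commutes with [w]; as z^p is [w] times a power of [c], [z^p, x] =
    c^-p is trivial. In the applications, [w] is central because its order divides q. *)
Lemma expg_diff_sqr_eq1 (gT : finGroupType) (p : nat) (x y : gT) :
    prime p -> let z := x^-1 * y in
    commute x [~ x, y] -> commute y [~ x, y] ->
    [~ x, y] ^+ (p ^ 2) = 1 -> x ^+ (p ^ 2) = y ^+ (p ^ 2) ->
    (let w := x ^- p * y ^+ p in w ^+ p = 1 -> commute x w) ->
  z ^+ (p ^ 2) = 1.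
Proof.
move=> p_pr z cxc cyc cq1 xqyq Hw.
set c := [~ x, y] in cxc cyc cq1.
have [cxc' cyc'] : commute x c^-1 /\ commute y c^-1.
  by split; apply: commuteV.
have Dc : [~ y, x] = c^-1 by rewrite invg_comm.
have czc : commute z c^-1.
  by apply/commute_sym/commuteM; apply/commute_sym => //; apply/commute_sym/commuteV.
have Dzx : [~ z, x] = c^-1.
  rewrite commMgJ Dc; suff /eqP-> : [~ x^-1, x] == 1 by rewrite conj1g mul1g.
  exact/commgP/commute_sym/commuteV.
have Dy i : y ^+ i = x ^+ i * z ^+ i * c^-1 ^+ 'C(i, 2).
  have -> : y = x * z by rewrite mulKVg.
  by rewrite expMg_Rmul Dzx.
have cxy : commute (x ^+ p) (y ^+ p).
  apply/commgP/eqP; rewrite commXg ?commgX // -/c.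
    by rewrite -expgM mulnn.
  exact: commuteX.
move: Hw => /= Hw.
have{Hw} cxw : commute x (x ^- p * y ^+ p).
  apply: Hw; rewrite expgMn; last by apply/commute_sym/commuteV/commute_sym.
  by rewrite expgVn -!expgM mulnn xqyq mulVg.
have cp1 : c^-1 ^+ p = 1.
  rewrite -Dzx -commXg ?Dzx //; apply/eqP/commgP/commute_sym.
  have -> : z ^+ p = x ^- p * y ^+ p * c ^+ 'C(p, 2).
    by rewrite Dy !mulgA mulVg mul1g -mulgA expgVn mulVg mulg1.
  by apply: commuteM => //; apply: commuteX.
have /dvdnP[k Dk] := dvdn_bin2_sqr p_pr.
apply: (mulgI (x ^+ (p ^ 2))); rewrite mulg1 {2}xqyq Dy Dk (mulnC k) (expgM c^-1) cp1.
by rewrite expg1n mulg1.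
Qed.

Lemma commg_conj (gT : finGroupType) (x y : gT) : [~ x, x ^ y] = [~ x, [~ x, y]].
Proof.
rewrite -{1}(mulKVg x (x ^ y)) -commgEl commgMJ.
by rewrite (_ : [~ x, x] = 1) ?conj1g ?mulg1 //; apply/eqP/commgP.
Qed.

(** Otherwise [x] lies in a maximal subgroup, which is normal in a p-group and so contains the whole
    normal closure of [x]. *)
Lemma pgroup_normal_closure_cycle (gT : finGroupType) (p : nat) (L : {group gT}) x :
  p.-group L -> x \in L -> <<x ^: L>> = L -> L :=: <[x]>.
Proof.
move=> pL Lx defL; have sxL : <[x]> \subset L by rewrite cycle_subG.
have [// | [M maxM sxM]] := maximal_exists sxL.
have /andP[_ nML] := p_maximal_normal pL maxM.
have := maxgroupp maxM; rewrite properE => /andP[_ /negP[]].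
by rewrite -defL gen_subG class_sub_norm // -cycle_subG.
Qed.

(** Induction on the order of [L]. Unless [L] is cyclic, the normal closure [D] of [x] is proper,
    and induction in [D] shows that [x, [x, y]] = [x, x^y] has order dividing p^2, hence is central
    in [L]. Then [expg_diff_sqr_eq1] applies to [x] and its conjugate x^y, whose p^2-th powers
    agree. *)
Lemma comm_central_exp_eq1 (gT : finGroupType) p (L M : {group gT}) x :
    prime p -> p.-group L -> M <| L ->
    {in M, forall y, y ^+ (p ^ 2) = 1 -> y \in 'C(L)} ->
    x \in L -> x ^+ (p ^ 2) \in 'C(L) ->
  {in M, forall y, [~ x, y] ^+ (p ^ 2) = 1}.
Proof.
move=> p_pr; have [n] := ubnP #|L|; elim: n => // n IHn in L M x *.
rewrite ltnS => leLn pL nsML cML Lx cxqL y My.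
have [sML nML] := andP nsML; have Ly := subsetP sML y My.
pose D := <<x ^: L>>%G; have sDL : D \subset L.
  by rewrite gen_subG class_subG.
have [defD | ltDL] := eqVproper sDL.
  have defL := pgroup_normal_closure_cycle pL Lx defD.
  have /eqP-> : [~ x, y] == 1; last by rewrite expg1n.
  apply/commgP; move: Ly; rewrite defL => /cycleP[i ->].
  exact: commuteX.
have Dx : x \in D by rewrite mem_gen ?class_refl.
have Dxy : x ^ y \in D by rewrite mem_gen ?memJ_class.
have Dz : [~ x, y] \in D by rewrite commgEl groupM ?groupV.
have inM u : u \in L -> [~ u, y] \in M.
  by move=> Lu; rewrite commgEr groupM // memJ_norm ?groupV // (subsetP nML).
have Dc := commg_conj x y.
have cq1 : [~ x, x ^ y] ^+ (p ^ 2) = 1.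
  rewrite Dc; apply: (IHn D (M :&: D)%G).
  - exact: leq_trans (proper_card ltDL) leLn.
  - exact: pgroupS pL.
  - by rewrite /normal subsetIr normsI ?normG // (subset_trans sDL).
  - move=> u /setIP[Mu _] uq1; apply: subsetP (centS sDL) _ _; exact: cML.
  - by [].
  - by apply: subsetP (centS sDL) _ _.
  by rewrite inE inM.
have cL : [~ x, x ^ y] \in 'C(L).
  apply: cML cq1; rewrite Dc commgEr groupM ?memJ_norm ?groupV ?inM //.
  exact: subsetP nML x Lx.
have cC u v : u \in 'C(L) -> v \in L -> commute v u.
  by move/centP=> cu Lv; apply/commute_sym/cu.
rewrite commgEl; apply: expg_diff_sqr_eq1 => //.
- exact: cC.
- by apply: cC => //; apply: subsetP sDL _ _.
- by rewrite -conjXg conjgE -(cC _ _ cxqL Ly) mulKg.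
move=> w wp1; apply: cC => //; apply: cML.
  by rewrite /w -conjXg -commgEl inM ?groupX.
by rewrite expnS expgM wp1 expg1n.
Qed.

(* Alperin's theorem, for exponent p ^ 2: it fails for exponent p = 2. *)
Lemma cent_max_normal_abelian (gT : finGroupType) p (U A : {group gT}) :
    prime p -> p.-group U ->
    [max A | [&& A <| U, abelian A & exponent A %| p ^ 2]] ->
  {in 'C_U(A), forall x, x ^+ (p ^ 2) = 1 -> x \in A}.
Proof.
move=> p_pr pU /maxgroupP[/and3P[nsAU cAA expA] maxA] x.
have [n] := ubnP #|<<x ^: U>>|; elim: n x => // n IHn x.
rewrite ltnS => leDn /setIP[Ux cAx] xq1.
pose D := <<x ^: U>>%G; have sDU : D \subset U by rewrite gen_subG class_subG.
have nDU : U \subset 'N(D) by rewrite norms_gen // class_norm.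
have Dx : x \in D by rewrite mem_gen ?class_refl.
have cAD : D \subset 'C(A).
  rewrite gen_subG class_sub_norm ?cAx // norms_cent //.
  by case/andP: nsAU.
have [D1 | ntD] := eqVneq (D : {set gT}) 1.
  by move: Dx; rewrite D1 => /set1P->; exact: group1.
(* [M] is proper in [D] since [U] is nilpotent, and it contains the normal closures of its elements,
   so the induction hypothesis applies to them. *)
pose M := [~: D, U]%G.
have ltMD : M \proper D.
  by apply: nil_comm_properl (pgroup_nil pU) sDU ntD _; rewrite subsetI subxx.
have nMU : U \subset 'N(M) by rewrite normsR // normG.
have inA y : y \in M -> y ^+ (p ^ 2) = 1 -> y \in A.
  move=> My; have Dy := subsetP (proper_sub ltMD) y My; apply: IHn.
    apply: leq_trans leDn; apply: leq_ltn_trans (proper_card ltMD).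
    by rewrite subset_leq_card // gen_subG class_sub_norm.
  by rewrite inE (subsetP sDU) // (subsetP cAD).
have cD u v : u \in A -> v \in D -> commute v u.
  by move=> Au Dv; exact: (centP (subsetP cAD v Dv)).
have inM v u : v \in D -> u \in U -> [~ v, u] \in M.
  by move=> Dv Uu; rewrite mem_commg.
(* Elements of [M] of order dividing p^2 lie in [A], hence centralize [D]. This puts [x, x^u] in
   [A], and the power argument then applies to [x] and x^u. *)
have Axu u : u \in U -> [~ x, u] \in A.
  move=> Uu; apply: (inA); first exact: inM.
  have Dxu : x ^ u \in D by rewrite memJ_norm // (subsetP nDU).
  have Mc : [~ x, x ^ u] \in M by apply: inM => //; exact: subsetP sDU _ _.
  have cq1 : [~ x, x ^ u] ^+ (p ^ 2) = 1.
    rewrite commg_conj; apply: (@comm_central_exp_eq1 _ p D M) => //.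
    - exact: pgroupS pU.
    - by rewrite /normal (proper_sub ltMD) (subset_trans sDU).
    - by move=> y My yq1; apply/centP => v Dv; apply/commute_sym/cD => //; exact: inA.
    - by rewrite xq1.
    exact: inM.
  have Ac := inA _ Mc cq1.
  rewrite commgEl; apply: expg_diff_sqr_eq1 => //; try exact: cD.
    by rewrite -conjXg xq1 conj1g.
  move=> w wp1; apply: cD => //; apply: (inA).
    by rewrite /w -conjXg -commgEl inM ?groupX.
  by rewrite expnS expgM wp1 expg1n.
(* [B] is normal because every [x, u] is in [A]; maximality of [A] then gives B = A. *)
pose B := (A <*> <[x]>)%G.
have cAX : <[x]> \subset 'C(A) by rewrite cycle_subG.
have defB : B :=: A * <[x]> by rewrite /B /= cent_joinEr.
have Bx : x \in B by rewrite -cycle_subG joing_subr.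
rewrite -(maxA B) ?joing_subl //; apply/and3P; split.
- rewrite /normal join_subG (normal_sub nsAU) cycle_subG Ux /=.
  apply/subsetP=> u Uu; rewrite inE conjYg join_subG -cycleJ cycle_subG conjg_mulR.
  rewrite (normsP (normal_norm nsAU)) // joing_subl groupM //.
  exact: subsetP (joing_subl A <[x]>) _ (Axu u Uu).
- by rewrite abelianY cAA cycle_abelian.
apply/exponentP => b; rewrite defB => /mulsgP[a _ Aa /cycleP[i ->] ->].
rewrite expgMn; last by apply/commuteX/commute_sym/(centP cAx).
by rewrite (exponentP expA) // mul1g expgAC xq1 expg1n.
Qed.

(* By induction along L / Z for Z the elements of order dividing p ^ 2: the p ^ 2-th power
   map embeds the corresponding elements of L / Z into Z :&: K. *)
Lemma card_exponent_quotient_le (gT : finGroupType) p (L K : {group gT}) :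
    prime p -> p.-group L -> 'Ldiv_(p ^ 2)(L) \subset 'C(L) ->
    K <| L -> {in L, forall x, x ^+ (p ^ 2) \in K} ->
  #|L| <= #|'Ldiv_(p ^ 2)(L)| * #|K|.
Proof.
move=> p_pr; have [n] := ubnP #|L|; elim: n gT L K => // n IHn gT L K.
rewrite ltnS => leLn pL cL nsKL expK.
have gZ : group_set 'Ldiv_(p ^ 2)(L).
  apply/group_setP; split=> [|x y]; first by rewrite !inE group1 expg1n eqxx.
  case/LdivP=> Lx xq1 /LdivP[Ly yq1].
  rewrite !inE groupM // expgMn ?xq1 ?mul1g ?yq1 ?eqxx //.
  by apply: (centP (subsetP cL x _) y Ly); rewrite !inE Lx xq1 eqxx.
have [Z defZ] : exists Z : {group gT}, Z :=: 'Ldiv_(p ^ 2)(L) by exists (Group gZ).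
clear gZ; rewrite -defZ in cL *.
have inZ x : x \in L -> x ^+ (p ^ 2) = 1 -> x \in Z.
  by move=> Lx xq1; rewrite defZ !inE Lx xq1 eqxx.
have sZL : Z \subset L by rewrite defZ subsetIl.
have cZ u v : u \in Z -> v \in L -> commute v u.
  by move=> Zu Lv; apply/commute_sym/(centP (subsetP cL u Zu)).
have nZL : L \subset 'N(Z) by rewrite cents_norm // centsC.
have [L1 | ntL] := eqVneq (L : {set gT}) 1.
  by rewrite {1}L1 cards1 muln_gt0 !cardG_gt0.
have ntZ : 1 < #|Z|.
  have [_ pdvL _] := pgroup_pdiv pL ntL.
  have [x Lx ox] := Cauchy p_pr pdvL.
  rewrite cardG_gt1; apply/trivgPn; exists x; last first.
    by rewrite -order_gt1 ox prime_gt1.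
  by apply: (inZ); rewrite // expnS expgM -ox expg_order expg1n.
(* This makes the elements of order dividing p^2 central in [L / Z], as the induction requires. *)
have comm_q x y : x \in L -> y \in L -> x ^+ (p ^ 2) \in Z -> [~ x, y] \in Z.
  move=> Lx Ly Zxq; apply: (inZ); first by rewrite groupR.
  apply: (comm_central_exp_eq1 p_pr pL (normal_refl L)) => //.
    by move=> u Lu uq1; apply: (subsetP cL); apply: (inZ).
  exact: (subsetP cL).
have cardL : #|L| = (#|Z| * #|L / Z|)%N by rewrite card_quotient // Lagrange.
have cardK : #|K| = (#|K :&: Z| * #|K / Z|)%N.
  by rewrite card_quotient ?LagrangeI // (subset_trans (normal_sub nsKL)).
rewrite cardL cardK leq_pmul2l ?cardG_gt0 //.
have qZ x : x \in L -> coset Z x ^+ (p ^ 2) = 1 -> x ^+ (p ^ 2) \in Z.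
  move=> Lx xq1; apply: coset_idr; first by rewrite groupX ?(subsetP nZL).
  by rewrite morphX ?(subsetP nZL).
apply: leq_trans (IHn _ (L / Z)%G (K / Z)%G _ _ _ _ _) _.
- apply: leq_trans leLn.
  by rewrite /= cardL ltn_Pmull ?cardG_gt0.
- exact: quotient_pgroup.
- apply/subsetP=> _ /LdivP[/morphimP[x Nx Lx ->] xq1].
  apply/centP=> _ /morphimP[y Ny Ly ->]; apply/commgP.
  by rewrite -morphR //= coset_id // comm_q // qZ.
- exact: quotient_normal.
- move=> _ /morphimP[x Nx Lx ->] /=.
  by rewrite -morphX // mem_quotient // expK.
rewrite leq_mul2r; apply/orP; right.
pose f (xb : coset_of Z) := repr xb ^+ (p ^ 2).
have repL xb : xb \in L / Z -> repr xb \in L.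
  have nsZL : Z <| L by rewrite /normal sZL.
  by rewrite -{2}(quotientGK nsZL) => Lxb; apply/morphpreP; rewrite repr_coset_norm /= coset_reprK.
rewrite -(@card_in_imset _ _ f).
  rewrite subset_leq_card //; apply/subsetP=> _ /imsetP[xb /LdivP[Lxb xq1] ->].
  have Lx := repL _ Lxb.
  by rewrite inE expK // qZ ?coset_reprK.
move=> xb yb /LdivP[Lxb xq1] /LdivP[Lyb yq1]; rewrite /f => xqyq.
have [Lx Ly] := (repL _ Lxb, repL _ Lyb).
move: xq1; rewrite -(coset_reprK xb) -(coset_reprK yb) => xq1.
have Zxq := qZ _ Lx xq1.
set x := repr xb in Lx Zxq xqyq *; set y := repr yb in Ly xqyq *.
have [Nx Ny] := (subsetP nZL x Lx, subsetP nZL y Ly).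
apply/eqP; rewrite eq_mulVg1 -morphV // -morphM ?groupV //=.
apply/eqP/coset_id; apply: (inZ); first by rewrite groupM ?groupV.
have Zc : [~ x, y] \in Z by rewrite comm_q.
(* Equal p^2-th powers of [x] and [y] give x^-1 y a trivial one, so it lies in [Z]: this is the
   injectivity of [f]. *)
apply: expg_diff_sqr_eq1 => //; try exact: cZ.
  by move: Zc; rewrite defZ => /LdivP[].
move=> w wp1; apply: cZ => //; apply: (inZ); last by rewrite expnS expgM wp1 expg1n.
by rewrite groupM ?groupV ?groupX.
Qed.

(** Conjugation embeds the quotient of [U] by the centralizer in the permutations of [A]. *)
Lemma index_cent_le_fact (gT : finGroupType) (U A : {group gT}) :
  U \subset 'N(A) -> #|U : 'C_U(A)| <= #|A|`!.
Proof.
move=> nAU; rewrite indexgI /= -[U in #|U : _|](setIidPr nAU) -ker_conj_aut -card_morphim.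
rewrite -card_perm subset_leq_card //.
apply: subset_trans (Aut_conj_aut _ _) _.
by apply/subsetP=> a /setIdP[].
Qed.

Lemma large_normal_abelem (gT : finGroupType) p r (U K : {group gT}) :
    prime p -> p.-group U -> K <| U -> {in U, forall x, x ^+ (p ^ 2) \in K} ->
    let s := (p ^ (2 * r))%N in s`! * s <= #|U : K| ->
  exists E : {group gT}, [/\ E <| U, p.-abelem E & #|E| = (p ^ r)%N].
Proof.
move=> p_pr pU nsKU expK s le_s.
pose P (A : {group gT}) := [&& A <| U, abelian A & exponent A %| p ^ 2].
have P1 : P 1%G by rewrite /P normal1 abelian1 exponent1 dvd1n.
have [A maxA _] := @maxgroup_exists _ P 1%G P1.
have /andP[nsAU /andP[cAA expA]] := maxgroupp maxA.
have [sAU nAU] := andP nsAU; have pA := pgroupS sAU pU.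
pose C := 'C_U(A)%G.
have sAC : 'Ldiv_(p ^ 2)(C) \subset A.
  by apply/subsetP=> x /LdivP[Cx xq1]; apply: (cent_max_normal_abelian p_pr pU maxA).
have leC : #|C| <= #|A| * #|K|.
  apply: (@leq_trans (#|'Ldiv_(p ^ 2)(C)| * #|C :&: K|)).
    apply: (card_exponent_quotient_le p_pr).
    - exact: pgroupS (subsetIl _ _) pU.
    - by apply: subset_trans sAC _; rewrite centsC subsetIr.
    - by rewrite (normalGI (subsetIl _ _)).
    - by move=> x Cx; have /setIP[Ux _] := Cx; rewrite inE groupX //= expK.
  by rewrite leq_mul // subset_leq_card // subsetIr.
have leA : #|U : K| <= #|A|`! * #|A|.
  rewrite -(leq_pmul2l (cardG_gt0 K)) Lagrange ?normal_sub //.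
  rewrite -(Lagrange (subsetIl U 'C(A))).
  apply: leq_trans (leq_mul leC (index_cent_le_fact nAU)) _.
  by rewrite mulnC mulnA mulnC.
have {le_s leA} leA : s <= #|A|.
  rewrite leqNgt; apply/negP=> ltAs; have := leq_trans le_s leA.
  apply/negP; rewrite -ltnNge; apply: (@leq_ltn_trans (s`! * #|A|)).
    by rewrite leq_mul ?leq_fact // ltnW.
  by rewrite ltn_pmul2l ?fact_gt0.
have cOO : abelian 'Ohm_1(A) by exact: abelianS (Ohm_sub 1 A) cAA.
have abelO : p.-abelem 'Ohm_1(A) by rewrite Ohm1_abelem.
have sMO : 'Mho^1(A) \subset 'Ohm_1(A).
  rewrite (MhoEabelian 1 pA cAA) (OhmEabelian pA cOO).
  apply/subsetP=> _ /imsetP[x Ax ->]; rewrite !inE groupX // -expgM.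
  by apply/eqP; apply: (exponentP expA).
(* As [A] has exponent dividing p^2, its order |Ohm_1| |Mho^1| is at most |Ohm_1|^2; hence the
   factor 2 in the exponent of [s]. *)
have leO : r <= logn p #|'Ohm_1(A)|.
  have pO := abelem_pgroup abelO.
  rewrite -(leq_exp2l _ _ (prime_gt1 p_pr)) -p_part part_pnat_id //.
  rewrite -(leq_exp2r _ _ (isT : 0 < 2)) -expnM mulnC (leq_trans leA) //.
  by rewrite -(mul_card_Ohm_Mho_abelian 1 cAA) leq_mul2l subset_leq_card ?orbT.
have nsOU : 'Ohm_1(A) <| U by exact: char_normal_trans (Ohm_char 1 A) nsAU.
have [E [sEO nsEU cardE]] := normal_pgroup pU nsOU leO.
by exists E; split; rewrite // (abelemS sEO).
Qed.

(** * Sufficiency *)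

Lemma dprod_cycle_abelem_isog (gT : finGroupType) p m n (z : gT) (E L : {group gT}) :
    prime p -> #[z] = (p ^ m)%N -> p.-abelem E -> #|E| = (p ^ n)%N ->
    <[z]> \x E = L ->
  L \isog setX (Zp (p ^ m)%N) [set: 'rV['F_p]_n].
Proof.
move=> p_pr oz abelE oE defL.
apply: isog_dprod defL (setX_dprod (Zp_group (p ^ m)) [group of [set: 'rV['F_p]_n]]) _ _.
  by apply: isog_trans (isog_setX1 _ _); rewrite /= -oz isog_sym Zp_isog.
apply: isog_trans (isog_set1X _ _).
by rewrite (isog_abelem_card _ abelE) fin_Fp_lmod_abelem // cardsT card_mx mul1n card_Fp //= oE.
Qed.

(** The factorial bounds the index in <x> of the centralizer of [E], which leaves a centralizing [z]
    of order p^m. The rank n + 1 of [E] leaves room for its intersection with <z>, which is cyclic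
    and elementary abelian, so of order at most p. *)
Lemma large_pgroup_elementary_by_cyclic
    (gT : finGroupType) p m n (U K : {group gT}) x :
    prime p -> p.-group U -> K <| U -> {in U, forall x, x ^+ (p ^ 2) \in K} ->
    let s := (p ^ (2 * n.+1))%N in s`! * s <= #|U : K| ->
    x \in U -> p ^ m * (p ^ n.+1)`! <= #[x] ->
  exists2 L : {group gT}, L \subset U &
    L \isog setX (Zp (p ^ m)%N) [set: 'rV['F_p]_n].
Proof.
move=> p_pr pU nsKU expK s le_s Ux le_x.
have [E [nsEU abelE cardE]] := large_normal_abelem p_pr pU nsKU expK le_s.
have sxU : <[x]> \subset U by rewrite cycle_subG.
have /cyclicP[y defY] : cyclic 'C_(<[x]>)(E) by apply: cyclicS (subsetIl _ _) (cycle_cyclic x).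
have sYx : <[y]> \subset <[x]> by rewrite -defY subsetIl.
have cEy : <[y]> \subset 'C(E) by rewrite -defY subsetIr.
have py : p.-group <[y]> := pgroupS (subset_trans sYx sxU) pU.
have le_y : p ^ m <= #[y].
  rewrite -(leq_pmul2r (fact_gt0 (p ^ n.+1))) (leq_trans le_x) //.
  have := index_cent_le_fact (subset_trans sxU (normal_norm nsEU)).
  by rewrite /= defY cardE -(leq_pmul2l (order_gt0 y)) Lagrange.
have oy : #[y] = (p ^ logn p #[y])%N := card_pgroup py.
set j := logn p #[y] in oy.
have le_mj : m <= j by rewrite -(leq_exp2l _ _ (prime_gt1 p_pr)) -oy.
pose z := y ^+ (p ^ (j - m)).
have oz : #[z] = (p ^ m)%N by rewrite (orderXexp _ oy) subKn.
have sZy : <[z]> \subset <[y]> by rewrite cycleX.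
have sEU := normal_sub nsEU; have sZU := subset_trans sZy (subset_trans sYx sxU).
have [F defE] := abelem_split_dprod abelE (subsetIl E <[z]>).
have [_ defEF _ tiF] := dprodP defE.
have sFE : F \subset E by rewrite -defEF mulG_subr.
have leF : p ^ n <= #|F|.
  rewrite -(leq_pmul2l (prime_gt0 p_pr)) -expnS -cardE -(dprod_card defE).
  rewrite leq_mul2r; apply/orP; right.
  have [trI | ntI] := eqVneq (E :&: <[z]>) 1; first by rewrite /= trI cards1 prime_gt0.
  rewrite (cyclic_abelem_prime (abelemS (subsetIl _ _) abelE) _ ntI) //.
  exact: cyclicS (subsetIr _ _) (cycle_cyclic z).
have pF := pgroupS sFE (abelem_pgroup abelE).
have {leF} leF : n <= logn p #|F|.
  by rewrite -(leq_exp2l _ _ (prime_gt1 p_pr)) -card_pgroup.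
have [V [sVF _ oV]] := normal_pgroup pF (normal_refl F) leF.
have sVE := subset_trans sVF sFE.
have tiV : <[z]> :&: V = 1.
  by apply/trivgP; rewrite /= -tiF !subsetI subsetIl !subIset ?sVE ?sVF ?orbT.
have cZV : V \subset 'C(<[z]>).
  by rewrite centsC (subset_trans sZy) // (subset_trans cEy) // centS.
exists (<[z]> <*> V)%G; first by rewrite join_subG sZU (subset_trans sVE).
apply: (@dprod_cycle_abelem_isog _ p m n z V); rewrite ?(abelemS sVE) //.
by rewrite dprodEY.
Qed.

Lemma exists_order k : 0 < k -> exists (cT : finGroupType) (c : cT), #[c] = k.
Proof. by case: k => // k _; exists 'I_k.+1, Zp1; exact: order_Zp1. Qed.

Lemma forcesP (gT hT : finGroupType) (G : {group gT}) (H : {group hT}) :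
  forces G H <->
  forall (uT : finGroupType) (U : {group uT}) (f : {morphism U >-> gT}),
    f @* U = G -> exists2 K : {group uT}, K \subset U & K \isog H.
Proof.
split=> forceH uT U => [f imf | [N nsNU isoG]].
  by apply: forceH; exists ('ker f)%G; rewrite ?ker_normal // -imf first_isog.
have [g injg img] := isogP isoG.
have sUdom : U \subset 'dom (g \o coset N).
  by rewrite -sub_morphim_pre ?subxx ?normal_norm.
apply: (forceH _ _ (restrm_morphism sUdom [morphism of g \o coset N])).
by rewrite morphim_restrm setIid morphim_comp.
Qed.

Lemma pgroup_forces_elementary_by_cyclic (p : nat) (hT : finGroupType) (H : {group hT}) :
    prime p -> elementary_by_cyclic p H ->
  exists (gT : finGroupType) (G : {group gT}), p.-group G /\ forces G H.
Proof.
move=> p_pr [m [n isoH]].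
(* Since k < p^k, these exponents make p^M and p^N exceed the two bounds of
   [large_pgroup_elementary_by_cyclic]. *)
pose M := (m + (p ^ n.+1)`!)%N; pose s := (p ^ (2 * n.+1))%N; pose N := (s`! * s)%N.
have [cT [c oc]] : exists (cT : finGroupType) (c : cT), #[c] = (p ^ M)%N.
  by apply: exists_order; rewrite expn_gt0 prime_gt0.
pose V := [group of [set: 'rV['F_p]_N]].
have abelV : p.-abelem V by exact: fin_Fp_lmod_abelem.
have oV : #|V| = (p ^ N)%N by rewrite cardsT card_mx mul1n card_Fp.
have pG : p.-group (setX <[c]> V).
  by rewrite /pgroup cardsX -orderE oc oV -expnD pnatX pnat_id.
exists (cT * 'rV['F_p]_N)%type, (setX_group <[c]> V); split=> //.
apply/forcesP => uT U f imf.
have [P sylP] := Sylow_exists p U; have [sPU pP _] := and3P sylP.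
have imP : f @* P = setX <[c]> V.
  by rewrite -imf; apply: pHall_id (morphim_pHall f sPU sylP) _; rewrite /= imf.
pose g := [morphism of @snd cT 'rV['F_p]_N \o f].
have imgP : g @* P = V by rewrite morphim_comp imP morphim_sndX.
have sPdom : P \subset f @*^-1 setT by rewrite morphpreT.
have nkP : P \subset 'N('ker g) := subset_trans sPdom (ker_norm g).
have [x Px fx] : exists2 x, x \in P & f x = (c, 1).
  have : (c, 1) \in f @* P by rewrite imP inE /= cycle_id group1.
  by case/morphimP=> x _ Px ->; exists x.
have [|||||L sLP isoL] :=
    @large_pgroup_elementary_by_cyclic _ p m n P (P :&: 'ker g)%G x p_pr pP.
- by rewrite /normal subsetIl normsI ?normG.
- move=> y Py; rewrite inE groupX //=; apply/kerP; first by rewrite (subsetP sPdom) ?groupX.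
  have [_ expV] := abelemP p_pr abelV.
  by rewrite morphX ?(subsetP sPdom) // expnS expgM expV ?expg1n ?inE.
- rewrite indexgI; have := card_morphim g P.
  by rewrite (setIidPr sPdom) imgP oV => <-; rewrite ltnW // ltn_expl ?prime_gt1.
- by [].
- have: #[f x] %| #[x] by rewrite morph_order // (subsetP sPU).
  move/(dvdn_leq (order_gt0 x)); apply: leq_trans.
  rewrite fx (order_injm (injm_pairg1 cT 'rV['F_p]_N)) ?inE //.
  by rewrite oc expnD leq_mul2l ltnW ?orbT // ltn_expl ?prime_gt1.
exists L; first exact: subset_trans sPU.
by apply: isog_trans isoL _; rewrite isog_sym.
Qed.

Lemma nilpotent_supplement (gT rT : finGroupType) (U : {group gT}) (f : {morphism U >-> rT}) :
  nilpotent (f @* U) ->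
  exists V : {group gT}, [/\ V \subset U, f @* V = f @* U & nilpotent V].
Proof.
move=> nilfU; pose supp (V : {group gT}) := (V \subset U) && (f @* V == f @* U).
have suppU : supp U by rewrite /supp subxx /=.
have [V /mingroupP[/andP[sVU /eqP imV] minV] _] := mingroup_exists suppU.
exists V; split=> //.
suff sVF : V \subset 'F(V) by apply: nilpotentS sVF (Fitting_nil V).
rewrite -{1}(Sylow_gen V) gen_subG; apply/bigcupsP=> P /SylowP[p p_pr sylP].
have [sPV pP _] := and3P sylP; have sPU := subset_trans sPV sVU.
apply: Fitting_max (pgroup_nil pP).
have nsfP : f @* P <| f @* V.
  have sylfP : p.-Sylow(f @* U) (f @* P) by rewrite -imV morphim_pHall.
  by rewrite imV (nilpotent_Hall_pcore nilfU sylfP) pcore_normal.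
(* By the Frattini argument V = M N_V(P), and [M] has the same image as [P], so N_V(P) still maps
   onto the image of [U]. Minimality makes every Sylow subgroup of [V] normal. *)
pose M := (V :&: f @*^-1 (f @* P))%G.
have nsMV : M <| V.
  rewrite /normal subsetIl normsI ?normG //.
  by rewrite (subset_trans _ (morphpre_norms f (normal_norm nsfP))) // -sub_morphim_pre.
have sylM : p.-Sylow(M) P.
  apply: pHall_subl sylP; rewrite ?subsetIl // subsetI sPV.
  by rewrite /= -sub_morphim_pre.
have defV := Frattini_arg nsMV sylM.
have fN : f @* 'N_V(P) = f @* U.
  apply/eqP; rewrite eqEsubset morphimS ?subIset ?sVU //= -imV -{1}defV.
  rewrite morphimMl; last by rewrite subIset ?sVU.
  rewrite mul_subG //; apply: subset_trans (morphimS f (subsetIr V _)) _.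
  rewrite morphpreK ?morphimS //; last by rewrite subsetI sPV normG.
have := minV ('N_V(P))%G; rewrite /supp subIset ?sVU //= fN eqxx subsetIl => /(_ isT isT) <-.
by rewrite normal_subnorm.
Qed.

Lemma forces_setX (pi : nat_pred) (gT1 gT2 hT : finGroupType)
    (G1 : {group gT1}) (G2 : {group gT2}) (H1 H2 H : {group hT}) :
    pi.-group G1 -> pi^'.-group G2 -> nilpotent G1 -> nilpotent G2 ->
    forces G1 H1 -> forces G2 H2 -> H1 \x H2 = H ->
  nilpotent (setX G1 G2) /\ forces (setX_group G1 G2) H.
Proof.
move=> pG1 pG2 nilG1 nilG2 forces1 forces2 defH.
have nilG : nilpotent (setX G1 G2).
  rewrite (dprod_nil (setX_dprod G1 G2)) -(isog_nil (isog_setX1 _ _)) nilG1.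
  by rewrite -(isog_nil (isog_set1X _ _)).
split=> //; apply/forcesP=> uT U f imf.
have [|V [sVU imV nilV]] := @nilpotent_supplement _ _ U f; first by rewrite imf.
have defV := nilpotent_pcoreC pi nilV.
(* The rho-core of the nilpotent [V] is a Hall subgroup, so its image in the rho-group [R] is a Hall
   rho-subgroup, that is, all of [R]. *)
have part (rho : nat_pred) (rT : finGroupType) (R : {group rT})
    (h : {morphism [set: gT1 * gT2] >-> rT}) :
  rho.-group R -> h @* setX G1 G2 = R -> forall K : {group hT},
  forces R K -> exists2 L : {group uT}, L \subset 'O_rho(V) & L \isog K.
- move=> rhoR imh K /forcesP forcesR.
  have sOU : 'O_rho(V) \subset U := subset_trans (pcore_sub _ _) sVU.
  have sOdom : 'O_rho(V) \subset 'dom (h \o f) by rewrite /dom /= morphpreT.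
  apply: (forcesR _ _ (restrm_morphism sOdom [morphism of h \o f])).
  rewrite morphim_restrm setIid morphim_comp.
  have hallO := nilpotent_pcore_Hall rho nilV.
  have := morphim_pHall h (subsetT _) (morphim_pHall f sOU hallO).
  rewrite /= imV imf imh => hallR; exact: pHall_id hallR rhoR.
have [L1 sL1 isoL1] := part pi _ G1 _ pG1 (morphim_fstX G1 G2) _ forces1.
have [L2 sL2 isoL2] := part pi^' _ G2 _ pG2 (morphim_sndX G1 G2) _ forces2.
have [_ _ cO tiO] := dprodP defV.
have defL : L1 \x L2 = L1 <*> L2.
  rewrite dprodEY ?(centSS sL2 sL1) //.
  by apply/trivgP; rewrite -tiO setISS.
exists (L1 <*> L2)%G; last exact: isog_dprod defL defH isoL1 isoL2.
by rewrite join_subG !(subset_trans _ sVU) ?(subset_trans _ (pcore_sub _ V)) //;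
  rewrite ?(subset_trans sL1) ?(subset_trans sL2) ?pcore_sub.
Qed.

Lemma elementary_by_cyclic1 (p : nat) (hT : finGroupType) :
  prime p -> elementary_by_cyclic p [1 hT]%G.
Proof.
move=> p_pr; exists 0, 0; apply: (@dprod_cycle_abelem_isog _ p 0 0 1 1%G) => //.
- by rewrite order1.
- exact: abelem1.
- by rewrite cards1.
by rewrite cycle1 dprodg1.
Qed.

(** Nilpotency of [G] and the restriction on its primes serve the induction, which splits off one
    Sylow subgroup of [H] and recombines with [forces_setX]. *)
Lemma abelian_elementary_by_cyclic_forcible (hT : finGroupType) (H : {group hT}) :
    abelian H ->
    (forall (p : nat) (P : {group hT}),
       prime p -> p.-Sylow(H) P -> elementary_by_cyclic p P) ->
  exists (gT : finGroupType) (G : {group gT}),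
    [/\ \pi(H).-group G, nilpotent G & forces G H].
Proof.
have [n] := ubnP #|H|; elim: n H => // n IHn H; rewrite ltnS => leHn cHH ebcH.
have [H1 | ntH] := eqVneq (H : {set hT}) 1.
  exists hT, 1%G; split; rewrite ?pgroup1 ?nilpotent1 //.
  by move=> uT U _; exists 1%G; rewrite ?sub1G // H1 trivial_isog.
have p_pr : prime (pdiv #|H|) by rewrite pdiv_prime // cardG_gt1.
set p := pdiv #|H| in p_pr.
have pH : p \in \pi(H) by rewrite pi_pdiv cardG_gt1.
have nilH := abelian_nil cHH; have defH := nilpotent_pcoreC p nilH.
have hallP := nilpotent_pcore_Hall p nilH.
have hallQ := nilpotent_pcore_Hall p^' nilH.
set P := 'O_p(H)%G in defH hallP; set Q := 'O_p^'(H)%G in defH hallQ.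
have [gT1 [G1 [pG1 forces1]]] := pgroup_forces_elementary_by_cyclic p_pr (ebcH p P p_pr hallP).
have [||q R q_pr sylR|gT2 [G2 [pG2 nilG2 forces2]]] := IHn Q.
- apply: leq_trans leHn; rewrite (card_Hall hallQ).
  by rewrite -[X in _ < X](partnC p (cardG_gt0 H)) ltn_Pmull ?part_gt0 // p_part_gt1.
- exact: abelianS (pHall_sub hallQ) cHH.
- have [sRQ qR _] := and3P sylR.
  have [eq_qp | neq_qp] := eqVneq q p.
    suff -> : R = 1%G by apply: elementary_by_cyclic1.
    apply/val_inj/card1_trivg/(pnat_1 (pi := p)); first by rewrite -eq_qp.
    exact: pgroupS sRQ (pHall_pgroup hallQ).
  by apply: ebcH q_pr _; apply: subHall_Sylow hallQ _ sylR; rewrite !inE.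
have p'G2 : p^'.-group G2.
  by apply: sub_pgroup pG2 => q; apply: pnatPpi (pHall_pgroup hallQ).
have [nilG forcesG] := forces_setX pG1 p'G2 (pgroup_nil pG1) nilG2 forces1 forces2 defH.
exists _, (setX_group G1 G2); split=> //.
rewrite /pgroup /= cardsX pnatM; apply/andP; split.
  by apply: sub_pgroup pG1 => q /eqnP->.
apply: sub_pgroup pG2; apply: piSg; exact: pHall_sub hallQ.
Qed.

(** * Abelian covers *)

Section Wreath.

Variables eT gT : finGroupType.

(** The regular wreath product of [eT] by [gT], with [gT] translating the arguments of functions.
    The record gives the pairs a type of their own to carry the twisted law. *)
Record wreath := Wreath { wreath_val : {ffun gT -> eT} * gT }.

HB.instance Definition _ := [isNew for wreath_val].
HB.instance Definition _ := [Finite of wreath by <:].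

Implicit Types u v w : wreath.

Definition base u := (wreath_val u).1.
Definition top u := (wreath_val u).2.

Definition wreath_one := Wreath ([ffun=> 1], 1).
Definition wreath_mul u v :=
  Wreath ([ffun g => base u g * base v (g * top u)], top u * top v).
Definition wreath_inv u := Wreath ([ffun g => (base u (g * (top u)^-1))^-1], (top u)^-1).

Lemma wreath_eqP u v : base u =1 base v -> top u = top v -> u = v.
Proof.
case: u v => [[f x]] [[f' x']] eq_f eq_x; congr (Wreath (_, _)) => //.
exact/ffunP.
Qed.

Lemma wreath_mulA : associative wreath_mul.
Proof.
move=> u v w; apply: wreath_eqP => [g|]; last exact: mulgA.
by rewrite /base /= !ffunE /= !mulgA.
Qed.

Lemma wreath_mul1 : left_id wreath_one wreath_mul.
Proof.
move=> u; apply: wreath_eqP => [g|]; last exact: mul1g.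
by rewrite {1}/base /= !ffunE mul1g mulg1.
Qed.

Lemma wreath_mulV : left_inverse wreath_one wreath_inv wreath_mul.
Proof.
move=> u; apply: wreath_eqP => [g|]; last exact: mulVg.
by rewrite {1}/base /= !ffunE mulVg.
Qed.

HB.instance Definition _ :=
  Finite_isGroup.Build wreath wreath_mulA wreath_mul1 wreath_mulV.

Lemma baseM u v g : base (u * v) g = base u g * base v (g * top u).
Proof. by rewrite ffunE. Qed.

Lemma topM u v : top (u * v) = top u * top v. Proof. by []. Qed.

Lemma base1 g : base 1 g = 1. Proof. by rewrite ffunE. Qed.

End Wreath.

(** The cover is of the whole ambient group [gT]; [forces_abelian_cover] restricts it to the
    preimage of [G]. *)
Definition abelian_cover n (gT uT : finGroupType) (U : {group uT})
    (f : {morphism U >-> gT}) :=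
  [/\ f @* U = setT, abelian ('ker f) & exponent ('ker f) %| n].

Lemma abelian_cover_id n (gT : finGroupType) : abelian_cover n (idm_morphism [set: gT]).
Proof. by split; rewrite ?morphim_idm ?ker_idm ?abelian1 ?exponent1 ?dvd1n. Qed.

Section CoinducedCover.

Variables (eT gT : finGroupType) (E : {group eT}) (pi : {morphism E >-> gT}).

(* S acts on gT by left translation, and r is an S-equivariant map to S. The coinduced
   group consists of the (f, x) such that f : gT -> E is S-invariant and lifts
   g |-> (r g)^-1 * r (g * x); evaluation of f at 1 is the map to E over S. *)
Let S := pi @* E.
Let r (g : gT) := g * (repr (S :* g))^-1.

Let rS s g : s \in S -> r (s * g) = s * r g.
Proof. by move=> Ss; rewrite /r rcosetM rcoset_id // -mulgA. Qed.

Let r_in g : r g \in S.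
Proof.
by rewrite /r; have /rcosetP[s Ss ->] := mem_repr_rcoset S g; rewrite invMg mulKVg groupV.
Qed.

Let coind_set := [set u : wreath eT gT | [forall g, [&& base u g \in E,
   pi (base u g) == (r g)^-1 * r (g * top u) & [forall s in S, base u (s * g) == base u g]]]].

Let coindP u : reflect
  [/\ forall g, base u g \in E, forall g, pi (base u g) = (r g)^-1 * r (g * top u)
    & forall s g, s \in S -> base u (s * g) = base u g]
  (u \in coind_set).
Proof.
rewrite inE; apply: (iffP forallP) => [uP | [uE upi uS] g].
  split=> [g | g | s g Ss]; have /and3P[// uE /eqP// _ /forall_inP uS] := uP g.
  exact/eqP/uS.
by rewrite uE upi eqxx; apply/forall_inP=> s Ss; rewrite uS.
Qed.

Let coind_group_set : group_set coind_set.
Proof.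
apply/group_setP; split=> [|u v /coindP[uE upi uS] /coindP[vE vpi vS]]; apply/coindP.
  split=> [g | g | s g _]; rewrite !base1 ?group1 // morph1.
  by rewrite mulg1 mulVg.
split=> [g | g | s g Ss]; rewrite !baseM ?groupM //.
  by rewrite morphM // upi vpi -mulgA mulKVg -mulgA.
by rewrite -mulgA uS // vS.
Qed.

Let coind := Group coind_group_set.

Let top_morphic : {in coind &, {morph @top eT gT : u v / u * v}}.
Proof. by []. Qed.

Let cover := Morphism top_morphic.

(** Over 1 the functions take values in the kernel of [pi], which bounds the kernel of [cover].
    Evaluation at 1 is multiplicative over [S] because the functions are S-invariant. *)
Lemma exists_abelian_cover n :
    abelian ('ker pi) -> exponent ('ker pi) %| n ->
  exists (uT : finGroupType) (U : {group uT}) (f : {morphism U >-> gT}),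
    abelian_cover n f /\
    exists psi : uT -> eT,
      {in f @*^-1 S &, {morph psi : u v / u * v}} /\
      {in f @*^-1 S, forall u, psi u \in E /\ pi (psi u) = f u}.
Proof.
move=> cKK expK; exists (wreath eT gT), coind, cover; split.
  have kerE u : u \in 'ker cover -> top u = 1 /\ forall g, base u g \in 'ker pi.
    case/morphpreP=> /coindP[uE upi _] /set1P/= tu1; split=> // g.
    by apply/kerP; rewrite ?upi ?tu1 ?mulg1 ?mulVg.
  split.
  (* The lift of a value depends on that value alone, and g |-> (r g)^-1 r (g x) is S-invariant, so
     the lifted function is S-invariant. The default 1 is never met on [S]. *)
  - apply/setP=> x; rewrite inE.
    pose lift y := odflt 1 [pick e in E | pi e == y].
    have liftP y : y \in S -> lift y \in E /\ pi (lift y) = y.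
      case/morphimP=> e Ee _ ->; rewrite /lift; case: pickP => [e' /andP[Ee' /eqP]//|].
      by move/(_ e); rewrite Ee eqxx.
    have rx g : (r g)^-1 * r (g * x) \in S by rewrite groupM ?groupV.
    pose u := Wreath ([ffun g => lift ((r g)^-1 * r (g * x))], x).
    have Uu : u \in coind.
      apply/coindP; split=> [g | g | s g Ss]; rewrite /base !ffunE.
      + by case: (liftP _ (rx g)).
      + by case: (liftP _ (rx g)).
      by rewrite -[s * g * x]mulgA !(rS _ Ss) invMg -mulgA mulKg.
    by apply/morphimP; exists u.
  - apply/centsP=> u /kerE[tu1 uK] v /kerE[tv1 vK].
    apply: wreath_eqP => [g|]; last by rewrite !topM tu1 tv1.
    by rewrite !baseM tu1 tv1 mulg1; apply: (centsP cKK).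
  apply/exponentP=> u Ku; have [tu1 uK] := kerE u Ku.
  have tuX k : top (u ^+ k) = 1.
    by elim: k => // k IHk; rewrite expgS topM tu1 IHk mulg1.
  have buX k g : base (u ^+ k) g = base u g ^+ k.
    elim: k => [|k IHk]; first by rewrite base1.
    by rewrite !expgS baseM tu1 mulg1 IHk.
  apply: wreath_eqP => [g|]; last exact: tuX.
  by rewrite buX base1 (exponentP expK).
(* The coset [S] itself has representative 1, so evaluation at 1 lies over the top component
   exactly. *)
have r1 : r 1 = 1 by rewrite /r rcoset1 repr_group invg1 mulg1.
exists (fun u => base u 1); split=> [u v | u].
  case/morphpreP=> Uu Su /morphpreP[/coindP[_ _ vS] _].
  by rewrite baseM mul1g -[top u]mulg1 vS.
case/morphpreP=> /coindP[uE upi _] Su; split=> //.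
by rewrite upi r1 invg1 !mul1g -[top u]mulg1 rS ?r1 ?mulg1.
Qed.

End CoinducedCover.

Section CommonCover.

Variables (n : nat) (gT : finGroupType) (I : eqType).
Variable P : I -> forall (uT : finGroupType) (U : {group uT}), {morphism U >-> gT} -> Prop.

Hypothesis P_pullback : forall i (uT vT : finGroupType) (U : {group uT}) (V : {group vT})
  (f : {morphism U >-> gT}) (g : {morphism V >-> gT}) (q : {morphism V >-> uT}),
  q @* V \subset U -> {in V, g =1 f \o q} -> P i f -> P i g.

Hypothesis P_cover : forall i, exists (uT : finGroupType) (U : {group uT})
  (f : {morphism U >-> gT}), abelian_cover n f /\ P i f.

(** Fibre products over [gT], starting from the identity cover: the kernel embeds in the product of
    the two kernels, and each factor passes on its properties along its projection. *)
Lemma common_abelian_cover (s : seq I) :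
  exists (uT : finGroupType) (U : {group uT}) (f : {morphism U >-> gT}),
    abelian_cover n f /\ {in s, forall i, P i f}.
Proof.
elim: s => [|i s [uT [U [f [[imf cKf expKf] Pf]]]]].
  exists gT, [set: gT]%G, (idm_morphism [set: gT]).
  by split=> //; exact: abelian_cover_id.
have [vT [V [g [[img cKg expKg] Pg]]]] := P_cover i.
pose W0 := [set w in setX U V | f w.1 == g w.2].
have gW : group_set W0.
  apply/group_setP; split=> [|x y]; first by rewrite !inE !group1 !morph1 /=.
  rewrite !inE => /andP[/andP[Ux Vx] /eqP fx] /andP[/andP[Uy Vy] /eqP fy].
  by rewrite !groupM //= !morphM // fx fy /=.
pose W := Group gW.
have WP w : w \in W -> [/\ w.1 \in U, w.2 \in V & f w.1 = g w.2].
  by rewrite !inE => /andP[/andP[? ?] /eqP].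
have fstM : {in W &, {morph (fun w : uT * vT => w.1) : x y / x * y}} by [].
have sndM : {in W &, {morph (fun w : uT * vT => w.2) : x y / x * y}} by [].
have hM : {in W &, {morph (fun w : uT * vT => f w.1) : x y / x * y}}.
  by move=> x y /WP[Ux _ _] /WP[Uy _ _]; rewrite -morphM.
pose h := Morphism hM.
have kerh w : w \in 'ker h -> w.1 \in 'ker f /\ w.2 \in 'ker g.
  case/morphpreP=> /WP[Uw Vw fw] /set1P/= hw.
  by split; apply/kerP; rewrite -?fw.
exists (uT * vT)%type, W, h; split; last first.
  move=> j; rewrite inE => /predU1P[-> | sj].
    apply: (P_pullback (q := Morphism sndM)) Pg.
      by apply/subsetP=> _ /morphimP[w _ /WP[? ? ?] ->].
    by move=> w /WP[].
  apply: (P_pullback (q := Morphism fstM)) (Pf j sj) => //.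
  by apply/subsetP=> _ /morphimP[w _ /WP[? ? ?] ->].
split.
- apply/setP=> x; rewrite inE.
  have /morphimP[u _ Uu Dxu] : x \in f @* U by rewrite imf inE.
  have /morphimP[v _ Vv Dxv] : x \in g @* V by rewrite img inE.
  apply/morphimP; exists (u, v) => //.
    by rewrite !inE /= Uu Vv -Dxu Dxv eqxx.
  by rewrite !inE /= Uu Vv -Dxu Dxv eqxx.
- apply/centsP=> w /kerh[w1K w2K] z /kerh[z1K z2K].
  by congr (_, _); [apply: (centsP cKf) | apply: (centsP cKg)].
apply/exponentP=> w /kerh[w1K w2K].
have wX k : w ^+ k = (w.1 ^+ k, w.2 ^+ k).
  by elim: k => // k IHk; rewrite !expgS IHk.
by rewrite wX (exponentP expKf) // (exponentP expKg).
Qed.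

End CommonCover.

(** Stated as an implication that is trivial at x = 1, so that it can be imposed on every [x] at
    once. *)
Definition no_root_lift n (gT : finGroupType) (x : gT) (uT : finGroupType) (U : {group uT})
    (f : {morphism U >-> gT}) :=
  {in U, forall u, f u = x -> u ^+ n = 1 -> x = 1}.

Definition no_commuting_lift p (gT : finGroupType) (x y : gT) (uT : finGroupType)
    (U : {group uT}) (f : {morphism U >-> gT}) :=
  commute x y -> #[x] = p -> #[y] = p -> y \notin <[x]> ->
  {in U &, forall u v, f u = x -> f v = y -> ~ commute u v}.

Lemma exists_no_root_lift n (gT : finGroupType) (x : gT) : 0 < n ->
  exists (uT : finGroupType) (U : {group uT}) (f : {morphism U >-> gT}),
    abelian_cover n f /\ no_root_lift n x f.
Proof.
move=> n_gt0.
have [eT [e oe]] : exists (eT : finGroupType) (e : eT), #[e] = (#[x] * n)%N.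
  by apply: exists_order; rewrite muln_gt0 order_gt0.
have dvd_xe : #[x] %| #[e] by rewrite oe dvdn_mulr.
pose pi := [morphism of eltm dvd_xe].
have piX k : pi (e ^+ k) = x ^+ k by exact: eltmE.
have [|| uT [U [f [cover_f [psi [psiM psiP]]]]]] := @exists_abelian_cover _ _ _ pi n.
- exact: abelianS (subsetIl _ _) (cycle_abelian e).
- apply/exponentP=> _ /morphpreP[/cycleP[k ->] /set1P].
  rewrite piX -expgM => /eqP; rewrite -order_dvdn => xk; apply/eqP.
  by rewrite -order_dvdn oe dvdn_pmul2r.
exists uT, U, f; split=> // u Uu fu un1.
have imx : x \in pi @* <[e]> by rewrite -[x]expg1 -piX mem_morphim ?mem_cycle.
pose D := f @*^-1 (pi @* <[e]>)%G.
have Du : u \in D by apply/morphpreP; rewrite fu.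
have psi1 : psi 1 = 1.
  by apply: (mulgI (psi 1)); rewrite mulg1 -psiM ?group1 // mulg1.
have psiX k : psi (u ^+ k) = psi u ^+ k.
  by elim: k => [|k IHk]; rewrite ?psi1 // !expgS psiM ?groupX // IHk.
have [/cycleP[k psiu]] := psiP u Du.
rewrite fu psiu piX => xk.
(* As #[x] n divides k n, #[x] divides k, and x = x^k = 1. *)
have /eqP : e ^+ (k * n) = 1 by rewrite expgM -psiu -psiX un1.
by rewrite -order_dvdn oe dvdn_pmul2r // order_dvdn xk => /eqP.
Qed.

Lemma commuting_order_p_abelem (gT : finGroupType) p (x y : gT) :
    prime p -> commute x y -> #[x] = p -> #[y] = p -> y \notin <[x]> ->
  p.-abelem (<[x]> <*> <[y]>) /\ #|<[x]> <*> <[y]>| = (p ^ 2)%N.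
Proof.
move=> p_pr cxy ox oy xy.
have cXY : <[y]> \subset 'C(<[x]>).
  by rewrite cent_cycle cycle_subG; apply/cent1P.
have tiXY : <[x]> :&: <[y]> = 1.
  by rewrite setIC prime_TIg -?orderE ?oy // cycle_subG.
split; last by rewrite cent_joinEr // TI_cardMg // -!orderE ox oy.
by rewrite (dprod_abelem p (dprodEY cXY tiXY)) !prime_abelem.
Qed.

Lemma exists_no_commuting_lift p (gT : finGroupType) (x y : gT) : prime p ->
  exists (uT : finGroupType) (U : {group uT}) (f : {morphism U >-> gT}),
    abelian_cover p f /\ no_commuting_lift p x y f.
Proof.
move=> p_pr.
have [/and4P[/eqP cxy /eqP ox /eqP oy xy] | no_pair] :=
  boolP [&& x * y == y * x, #[x] == p, #[y] == p & y \notin <[x]>]; last first.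
  (* For other pairs the condition is vacuous and the identity cover will do. *)
  exists gT, [set: gT]%G, (idm_morphism [set: gT]); split.
    exact: abelian_cover_id.
  by move=> cxy ox oy xy; rewrite cxy ox oy xy !eqxx in no_pair.
have [abelS oS] := commuting_order_p_abelem p_pr cxy ox oy xy.
set S := (<[x]> <*> <[y]>)%G in abelS oS.
pose E := [set: p^{1+2}%type]%G.
have pE : p.-group E := pX1p2_pgroup p_pr.
have esE : extraspecial E := pX1p2_extraspecial p_pr.
have oE : #|E| = (p ^ 3)%N := card_pX1p2 p_pr.
have oZ := card_center_extraspecial pE esE.
have [nsZE [[defPhi _] _]] := (center_normal E, esE).
have abelEZ : p.-abelem (E / 'Z(E)) by rewrite -defPhi Phi_quotient_abelem.
have isoES : E / 'Z(E) \isog S.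
  rewrite (isog_abelem_card _ abelEZ) abelS oS /= card_quotient ?normal_norm //.
  by rewrite -divgS ?normal_sub // oE oZ expnS mulKn ?prime_gt0.
have [h injh imh] := isogP isoES.
have sEdom : E \subset 'dom (h \o coset 'Z(E)).
  by rewrite -sub_morphim_pre ?subxx ?normal_norm.
pose pi := restrm_morphism sEdom [morphism of h \o coset 'Z(E)].
have impi : pi @* E = S by rewrite morphim_restrm setIid morphim_comp.
have kerZ : 'ker pi \subset 'Z(E).
  apply/subsetP=> e /morphpreP[Ee /set1P hce].
  apply: coset_idr; first by rewrite (subsetP (normal_norm nsZE)).
  by apply: (injmP injh); rewrite ?group1 ?mem_quotient // morph1.
have [|| uT [U [f [cover_f [psi [psiM psiP]]]]]] := @exists_abelian_cover _ _ _ pi p.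
- exact: abelianS kerZ (center_abelian E).
- by have := exponent_dvdn 'Z(E); rewrite oZ; apply: dvdn_trans (exponentS kerZ).
have imx : x \in pi @* E by rewrite impi (subsetP (joing_subl _ _)) ?cycle_id.
have imy : y \in pi @* E by rewrite impi (subsetP (joing_subr _ _)) ?cycle_id.
exists uT, U, f; split=> // _ _ _ _ u v Uu Uv fu fv cuv.
pose D := f @*^-1 (pi @* E)%G.
have Du : u \in D.
  by apply/morphpreP; rewrite fu.
have Dv : v \in D.
  by apply/morphpreP; rewrite fv.
have [[Eu piu] [Ev piv]] := (psiP u Du, psiP v Dv).
have cpsi : commute (psi u) (psi v) by rewrite /commute -!psiM // cuv.
case/negP: (extraspecial_nonabelian esE).
(* Commuting lifts and the centre would generate an abelian subgroup that contains the kernel of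
   [pi] and maps onto [S], hence all of [E]. *)
pose A := ('Z(E) <*> (<[psi u]> <*> <[psi v]>))%G.
have sAE : <[psi u]> <*> <[psi v]> \subset E by rewrite subsetT.
have cAA : abelian A.
  rewrite !abelianY center_abelian !cycle_abelian /= cent_cycle cycle_subG.
  apply/andP; split; first exact/cent1P.
  by rewrite (subset_trans sAE) // centsC subsetIr.
suff sEA : E \subset A by exact: abelianS sEA cAA.
rewrite -(morphimSGK (f := pi)) ?subxx //; last exact: subset_trans kerZ (joing_subl _ _).
have [Au Av] : psi u \in A /\ psi v \in A.
  have sBA : <[psi u]> <*> <[psi v]> \subset A by exact: joing_subr.
  by rewrite !(subsetP sBA) // -cycle_subG ?joing_subl ?joing_subr.
by rewrite impi join_subG !cycle_subG -fu -fv -piu -piv !mem_morphim.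
Qed.

(** * Necessity *)

(** Split off a cyclic factor <x> of order the exponent. If c^p were nontrivial for some [c] in the
    complement, so would be x^p, and the cyclic group ['Mho^1(P)] would contain subgroups of order p
    from both factors; these would coincide, against the trivial intersection. *)
Lemma cyclic_Mho1_elementary_by_cyclic (p : nat) (gT : finGroupType) (P : {group gT}) :
    prime p -> p.-group P -> abelian P -> cyclic 'Mho^1(P) ->
  elementary_by_cyclic p P.
Proof.
move=> p_pr pP cPP cycM.
have [C /(_ cPP)[x ox defP]] := abelian_type_subproof P.
have [_ defxC _ tiC] := dprodP defP.
have sCP : C \subset P by rewrite -defxC mulG_subr.
have Px : x \in P by rewrite -cycle_subG -defxC mulG_subl.
have pC := pgroupS sCP pP.
have MhoP y : y \in P -> y ^+ p \in 'Mho^1(P).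
  by move=> Py; rewrite (MhoEabelian 1 pP cPP) (imset_f (fun z => z ^+ (p ^ 1))).
have oOhm y : y \in P -> y ^+ p != 1 -> #|'Ohm_1(<[y ^+ p]>)| = p.
  move=> Py yp; apply: Ohm1_cyclic_pgroup_prime; rewrite ?cycle_cyclic ?cycle_eq1 //.
  by apply: pgroupS pP; rewrite cycle_subG groupX.
have abelC : p.-abelem C.
  apply/abelemP=> //; split=> [|c Cc]; first exact: abelianS sCP cPP.
  have Pc := subsetP sCP c Cc.
  apply/eqP/negPn/negP=> cp; have xp : x ^+ p != 1.
    apply: contra cp; rewrite -!order_dvdn ox; apply: dvdn_trans.
    exact: dvdn_exponent.
  have sOM y : y \in P -> 'Ohm_1(<[y ^+ p]>) \subset 'Mho^1(P).
    by move=> Py; apply: subset_trans (Ohm_sub _ _) _; rewrite cycle_subG MhoP.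
  have eqO : 'Ohm_1(<[x ^+ p]>) :=: 'Ohm_1(<[c ^+ p]>).
    by apply/eqP; rewrite (eq_subG_cyclic cycM) ?sOM ?oOhm.
  have : 'Ohm_1(<[c ^+ p]>) \subset [1 gT].
    rewrite -tiC subsetI -{1}eqO !(subset_trans (Ohm_sub _ _)) ?cycle_subG ?groupX //.
    exact: cycle_id.
  by move/subset_leq_card; rewrite cards1 oOhm // leqNgt prime_gt1.
exists (logn p #[x]), (logn p #|C|).
apply: dprod_cycle_abelem_isog p_pr _ abelC (card_pgroup pC) defP.
exact: card_pgroup (mem_p_elt pP Px).
Qed.

Lemma noncyclic_abelem_pair (p : nat) (gT : finGroupType) (M : {group gT}) :
    prime p -> p.-group M -> abelian M -> ~~ cyclic M ->
  exists c d, [/\ c \in M, d \in M, #[c] = p, #[d] = p & d \notin <[c]>].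
Proof.
move=> p_pr pM cMM; rewrite abelian_rank1_cyclic // (rank_pgroup pM) -ltnNge.
case/p_rank_geP=> E /pnElemP[sEM abelE dimE].
have oE : #|E| = (p ^ 2)%N by rewrite -dimE -card_pgroup ?abelem_pgroup.
have [_ expE] := abelemP p_pr abelE.
have /trivgPn[c Ec ntc] : E :!=: 1.
  by rewrite -cardG_gt1 oE -(exp1n 2) ltn_exp2r ?prime_gt1.
have oc : #[c] = p by apply: nt_prime_order; rewrite ?expE.
have /subsetPn[d Ed dc] : ~~ (E \subset <[c]>).
  apply/negP=> /subset_leq_card; rewrite -orderE oc oE leqNgt.
  by rewrite -{1}(expn1 p) ltn_exp2l ?prime_gt1.
have ntd : d != 1 by apply: contraNneq dc => ->; exact: group1.
by exists c, d; rewrite !(subsetP sEM) // (nt_prime_order p_pr (expE d Ed) ntd).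
Qed.

Lemma forces_abelian_cover (gT hT : finGroupType) (G : {group gT}) (H : {group hT})
    n (uT : finGroupType) (U : {group uT}) (f : {morphism U >-> gT}) :
    forces G H -> abelian_cover n f ->
  exists2 L : {group uT}, L \subset U & L \isog H.
Proof.
move/forcesP=> forcesH [imf _ _].
have sVU : f @*^-1 G \subset U := subsetIl _ _.
have [|L sLV isoL] := forcesH _ _ (restrm_morphism sVU f).
  by rewrite morphim_restrm setIid morphpreK // imf subsetT.
by exists L => //; apply: subset_trans sVU.
Qed.

Lemma forcible_abelian (hT : finGroupType) (H : {group hT}) : forcible H -> abelian H.
Proof.
case=> gT [G forcesH].
have [||uT [U [f [cover_f no_root]]]] :=
  @common_abelian_cover #|H| gT gT (@no_root_lift #|H| gT) _ _ (enum gT).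
- move=> x uT vT U V f g q sVU eq_gf Pf v Vv gv vn1.
  have Uqv : q v \in U by rewrite (subsetP sVU) ?mem_morphim.
  apply: (Pf (q v)) => //; first by rewrite -gv eq_gf.
  by rewrite -morphX // vn1 morph1.
- by move=> x; apply: exists_no_root_lift.
have [L sLU isoL] := forces_abelian_cover forcesH cover_f.
have [_ cKK _] := cover_f.
rewrite -(isog_abelian isoL); apply: abelianS cKK.
apply/subsetP=> u Lu; have Uu := subsetP sLU u Lu.
apply/kerP=> //; apply: (no_root (f u)) erefl _ => //; first by rewrite mem_enum.
by apply/eqP; rewrite -order_dvdn -(card_isog isoL) order_dvdG.
Qed.

Lemma forcible_cyclic_Mho1 (p : nat) (hT : finGroupType) (H P : {group hT}) :
    prime p -> forcible H -> abelian H -> P \subset H -> p.-group P ->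
  cyclic 'Mho^1(P).
Proof.
move=> p_pr [gT [G forcesH]] cHH sPH pP.
have cPP := abelianS sPH cHH.
pose cond (i : gT + gT * gT) : forall (uT : finGroupType) (U : {group uT}),
    {morphism U >-> gT} -> Prop :=
  match i with
  | inl x => @no_root_lift p gT x
  | inr xy => @no_commuting_lift p gT xy.1 xy.2
  end.
have [||uT [U [f [cover_f condf]]]] :=
  @common_abelian_cover p gT _ cond _ _ (enum {: gT + gT * gT}).
- move=> i uT vT U V f g q sVU eq_gf.
  have Uq v : v \in V -> q v \in U by move=> Vv; rewrite (subsetP sVU) ?mem_morphim.
  case: i => [x Pf v Vv gv vn1 | [x y] Pf cxy ox oy xy u v Vu Vv gu gv cuv].
    apply: (Pf (q v)); rewrite ?Uq //; first by rewrite -gv eq_gf.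
    by rewrite -morphX // vn1 morph1.
  apply: (Pf cxy ox oy xy (q u) (q v)); rewrite ?Uq //; try by rewrite -?gu -?gv eq_gf.
  by rewrite /commute -!morphM // cuv.
- case=> [x|[x y]]; last exact: exists_no_commuting_lift.
  exact: exists_no_root_lift (prime_gt0 p_pr).
have no_root u : u \in U -> u ^+ p = 1 -> f u = 1.
  by move=> Uu; apply: (condf (inl (f u))); rewrite ?mem_enum.
have [L sLU isoL] := forces_abelian_cover forcesH cover_f.
have [_ cKK expK] := cover_f.
apply: contraT => ncycM.
have [||c [d [Mc Md oc od dc]]] := noncyclic_abelem_pair p_pr _ _ ncycM.
- exact: pgroupS (Mho_sub 1 P) pP.
- exact: abelianS (Mho_sub 1 P) cPP.
have [h injh imh] := isogP (isog_symr isoL).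
move: Mc Md; rewrite /= (MhoEabelian 1 pP cPP).
case/imsetP=> a Pa Dc /imsetP[b Pb Dd]; rewrite expn1 in Dc Dd.
have [Ha Hb] := (subsetP sPH a Pa, subsetP sPH b Pb).
have Uh z : z \in H -> h z \in U.
  by move=> Hz; rewrite (subsetP sLU) // -imh mem_morphim.
pose x := f (h a); pose y := f (h b).
have fX k : f (h (a ^+ k)) = x ^+ k by rewrite !morphX ?Uh.
have fhp z : z \in H -> f (h z) = 1 -> z ^+ p = 1.
  move=> Hz fz; apply: (injmP injh); rewrite ?groupX //.
  rewrite morph1 morphX // (exponentP expK) //; apply/kerP=> //; exact: Uh.
(* The p-th power of f (h z) has the lift h (z^p), of trivial p-th power, so it is 1; and f (h z)
   itself is not 1, as kernel elements have trivial p-th power. *)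
have ord z : z \in H -> #[z ^+ p] = p -> #[f (h z)] = p.
  move=> Hz ozp; have zp := expg_order (z ^+ p); rewrite ozp in zp.
  apply: nt_prime_order => //.
    rewrite -!morphX ?Uh //; apply: no_root; first by rewrite Uh ?groupX.
    by rewrite -morphX ?groupX // zp morph1.
  apply/eqP=> /(fhp z Hz) zp1; move: (prime_gt1 p_pr).
  by rewrite -{1}ozp zp1 order1.
have cab : commute a b by exact: (centsP cHH).
(* If y = x^k, then a^-k b maps into the kernel, so its p-th power c^-k d is 1 and [d] lies in
   <c>. *)
have xy : y \notin <[x]>.
  apply: contra dc => /cycleP[k yk].
  have Hz : a ^- k * b \in H by rewrite groupM ?groupV ?groupX.
  have: (a ^- k * b) ^+ p = 1.
    apply: fhp Hz _.
    rewrite [h _]morphM ?groupV ?groupX // [h _^-1]morphV ?groupX //.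
    rewrite morphM ?groupV ?Uh ?groupX // morphV ?Uh ?groupX //.
    by rewrite fX -/y yk mulVg.
  rewrite expgMn; last by apply/commute_sym/commuteV/commuteX/commute_sym.
  rewrite expgVn expgAC -Dc -Dd => /eqP; rewrite -eq_mulVg1 => /eqP <-.
  exact: mem_cycle.
have cxy : commute x y.
  by rewrite /commute -!morphM ?Uh // cab.
have := condf (inr (x, y)); rewrite mem_enum => /(_ isT cxy).
rewrite !ord -?Dc -?Dd // => /(_ erefl erefl xy (h a) (h b)) [] //; try exact: Uh.
by rewrite /commute -!morphM // cab.
Qed.

Unset Implicit Arguments.

Theorem theorem1p3 (hT : finGroupType) (H : {group hT}) :
  forcible H <->
  abelian H /\
  (forall (p : nat) (P : {group hT}),
     prime p -> p.-Sylow(H) P -> elementary_by_cyclic p P).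
Proof.
split=> [forcH | [cHH ebcH]]; last first.
  have [gT [G [_ _ forcesH]]] := abelian_elementary_by_cyclic_forcible cHH ebcH.
  by exists gT, G.
have cHH := forcible_abelian forcH; split=> // p P p_pr /and3P[sPH pP _].
apply: cyclic_Mho1_elementary_by_cyclic => //; first exact: abelianS sPH cHH.
exact: forcible_cyclic_Mho1 sPH pP.
Qed.
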